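(* Let $G$ be a Lie group, $\pi:P\to M$ a principal $G$-bundle, and $\bar A$, $A$ connection forms on it. Let $B_0$ be an $L(G)$-valued $2$-form on $P$ with $B_0|_{pg}(vg,wg)=\mathrm{Ad}(g^{-1})B_0|_p(v,w)$ for all $p\in P$, $v,w\in T_pP$, $g\in G$, and $B_0(v,w)=0$ whenever $v$ or $w$ is vertical. Let $C^L_0,C^R_0$ be $L(G)$-valued $1$-forms on $P$ that vanish on vertical vectors and satisfy $C_0^{L,R}|_{pg}(vg)=\mathrm{Ad}(g^{-1})C_0^{L,R}|_p(v)$. Define the $L(G)$-valued $1$-form $\omega$ on $\mathcal{P}_{\bar A}P$ by $$\omega_{\bar\gamma}(\bar v)=A_{\bar\gamma(t_0)}\big(\bar v(t_0)\big)+C^R_0|_{\bar\gamma(t_1)}\big(\bar v(t_1)\big)-C^L_0|_{\bar\gamma(t_0)}\big(\bar v(t_0)\big)+\int_{t_0}^{t_1}B_0|_{\bar\gamma(t)}\big(\bar v(t),\bar\gamma'(t)\big)\,dt$$ for $\bar\gamma\in\mathcal{P}_{\bar A}P$ with domain $[t_0,t_1]$ and $\bar v\in T_{\bar\gamma}\mathcal{P}_{\bar A}P$. Then: (i) $\omega(\bar vg)=\mathrm{Ad}(g^{-1})\omega(\bar v)$ for all $g\in G$, all $\bar\gamma\in\mathcal{P}_{\bar A}P$ and all $\bar v\in T_{\bar\gamma}\mathcal{P}_{\bar A}P$; (ii) if $Y\in L(G)$ and $\tilde Y$ is the vector field along $\bar\gamma$ given by $\tilde Y(t)=\frac{d}{du}\big|_{u=0}\bar\gamma(t)\exp(uY)$,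 then $\omega(\tilde Y)=Y$.
   Context: $L(G)$ is the Lie algebra of $G$. For $v\in T_pP$ and $g\in G$, $vg\in T_{pg}P$ is the image of $v$ under the derivative of $p\mapsto pg$; a vector is vertical if $\pi_*$ maps it to $0$. $\mathcal{P}_{\bar A}P$ is the set of $C^\infty$ paths $\bar\gamma:[t_0,t_1]\to P$ ($t_0<t_1$ arbitrary), constant near $t_0$ and near $t_1$, with $\bar A(\bar\gamma'(t))=0$ for all $t$; paths differing by a translation of the time parameter are identified. $G$ acts on it by $(\bar\gamma g)(t)=\bar\gamma(t)g$. The tangent space $T_{\bar\gamma}\mathcal{P}_{\bar A}P$ is the vector space of $C^\infty$ vector fields $\bar v$ along $\bar\gamma$, constant near $t_0$ and $t_1$, satisfying $\frac{\partial}{\partial t}\bar A(\bar v(t))=F^{\bar A}(\bar\gamma'(t),\bar v(t))$ for all $t\in[t_0,t_1]$, where $F^{\bar A}$ is the curvature form of $\bar A$. For $\bar v\in T_{\bar\gamma}\mathcal{P}_{\bar A}P$, $\bar vg\in T_{\bar\gamma g}\mathcal{P}_{\bar A}P$ is $t\mapsto\bar v(t)g$. A $1$-form on $\mathcal{P}_{\bar A}P$ is an assignment of a linear map on each tangent space. *)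

(* Defs.v *)
From mathcomp Require Import all_boot all_order all_algebra.
From mathcomp Require Import all_classical all_reals all_analysis.

Set Implicit Arguments.
Unset Strict Implicit.
Unset Printing Implicit Defensive.

Import Order.TTheory GRing.Theory Num.Theory.
Import numFieldNormedType.Exports.

Local Open Scope classical_set_scope.
Local Open Scope ring_scope.

Section Smooth.
Context {R : realType} {V W : normedModType R}.

(* For an open set U of a finite-dimensional space V, this is C^k on U. *)
Fixpoint Ck_in (k : nat) (U : set V) (f : V -> W) : Prop :=
  match k with
  | 0%N => forall x, U x -> {for x, continuous f}
  | k'.+1 => (forall x, U x -> differentiable f x) /\
             forall v, Ck_in k' U (fun x => 'D_v f x)
  end.

Definition smooth_in (U : set V) (f : V -> W) := forall k, Ck_in k U f.

End Smooth.

(* Only cmap on cdom and cinv on the image of cdom are meaningful. *)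
Record chart (T E : Type) := Chart {
  cdom : set T;
  cmap : T -> E;
  cinv : E -> T }.

Definition cimg (T E : Type) (c : chart T E) : set E := cmap c @` cdom c.

Definition is_chart (T E : topologicalType) (c : chart T E) : Prop :=
  [/\ open (cdom c) /\ open (cimg c),
      forall p, cdom c p -> cinv c (cmap c p) = p,
      forall p, cdom c p -> {for p, continuous (cmap c)} &
      forall x, cimg c x -> {for x, continuous (cinv c)}].

Definition prod_chart (T S E F : Type) (c : chart T E) (d : chart S F) :
    chart (T * S) (E * F) :=
  Chart (cdom c `*` cdom d) (fun p => (cmap c p.1, cmap d p.2))
        (fun x => (cinv c x.1, cinv d x.2)).

Definition prod_atlas (T S E F : Type) (At : set (chart T E))
    (As : set (chart S F)) : set (chart (T * S) (E * F)) :=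
  [set e | exists c d, [/\ At c, As d & e = prod_chart c d]].

Definition model_atlas (E : Type) : set (chart E E) :=
  [set Chart setT id id].

(* The set W is meant to be open. *)
Definition smooth_on (R : realType) (T S : topologicalType)
    (E F : normedModType R) (At : set (chart T E)) (As : set (chart S F))
    (W : set T) (f : T -> S) : Prop :=
  (forall p, W p -> {for p, continuous f}) /\
  forall c d, At c -> As d ->
    smooth_in (cmap c @` (cdom c `&` W `&` f @^-1` cdom d))
              (cmap d \o f \o cinv c).

(* chart_at p is a preferred chart around p.  It serves to identify T_pM with *)
(* R^n: a tangent vector at p is represented by its coordinates in chart_at p,*)
(* so every T_pM below is the type 'rV[R]_n.                                  *)
Record manifold (R : realType) (n : nat) := Manifold {
  mcarrier :> topologicalType;
  atlas : set (chart mcarrier 'rV[R]_n);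
  chart_at : mcarrier -> chart mcarrier 'rV[R]_n;
  manifold_hausdorff : hausdorff_space mcarrier;
  manifold_countable : @second_countable mcarrier;
  atlas_chart : forall c, atlas c -> is_chart c;
  atlas_compat : forall c d, atlas c -> atlas d ->
    smooth_in (cmap c @` (cdom c `&` cdom d)) (cmap d \o cinv c);
  chart_at_atlas : forall p, atlas (chart_at p);
  chart_at_dom : forall p, cdom (chart_at p) p }.

Arguments atlas {R n} m.
Arguments chart_at {R n m} p.

Section Tangent.
Context {R : realType} {m n : nat} {M : manifold R m} {N : manifold R n}.

Definition tangent_map (f : M -> N) (p : M) : {linear 'rV[R]_m -> 'rV[R]_n} :=
  'd (cmap (chart_at (f p)) \o f \o cinv (chart_at p))
     (cmap (chart_at p) p).

Definition smooth_map (f : M -> N) := smooth_on (atlas M) (atlas N) setT f.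

Definition smooth_curve (c : R -> M) :=
  smooth_on (@model_atlas R^o) (atlas M) setT c.

Definition velocity (c : R -> M) (t : R) : 'rV[R]_m :=
  ((cmap (chart_at (c t)) \o c)^`())%classic t.

(* the coordinates in the chart c of the tangent vector v at p *)
Definition to_chart (c : chart M 'rV[R]_m) (p : M) (v : 'rV[R]_m) :
    'rV[R]_m :=
  'd (cmap c \o cinv (chart_at p)) (cmap (chart_at p) p) v.

(* the tangent vector at p whose coordinates in the chart c are u *)
Definition of_chart (c : chart M 'rV[R]_m) (p : M) (u : 'rV[R]_m) :
    'rV[R]_m :=
  'd (cmap (chart_at p) \o cinv c) (cmap c p) u.

Definition smooth_along (c : R -> M) (v : R -> 'rV[R]_m) : Prop :=
  forall d, atlas M d ->
    smooth_in ([set t | cdom d (c t)] : set R^o)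
              (fun t : R^o => to_chart d (c t) (v t)).

End Tangent.

Section Forms.
Context {R : realType} {m : nat} (M : manifold R m) (n : nat).

(* R^n-valued forms; smoothness is the separate predicate is_form1 / is_form2 *)
Definition form1 := M -> {linear 'rV[R]_m -> 'rV[R]_n}.
Definition form2 := M -> 'rV[R]_m -> 'rV[R]_m -> 'rV[R]_n.

Definition form1_loc (a : form1) (c : chart M 'rV[R]_m) (x u : 'rV[R]_m) :=
  a (cinv c x) (of_chart c (cinv c x) u).

Definition form2_loc (b : form2) (c : chart M 'rV[R]_m) (x u v : 'rV[R]_m) :=
  b (cinv c x) (of_chart c (cinv c x) u) (of_chart c (cinv c x) v).

Definition is_form1 (a : form1) : Prop :=
  forall c, atlas M c -> forall u, smooth_in (cimg c) (fun x => form1_loc a c x u).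

Definition is_form2 (b : form2) : Prop :=
  [/\ forall p v, linear (b p v),
      forall p w, linear (fun v => b p v w),
      forall p v, b p v v = 0 &
      forall c, atlas M c -> forall u v,
        smooth_in (cimg c) (fun x => form2_loc b c x u v)].

(* Normalized so that da(X,Y) = X(a(Y)) - Y(a(X)) - a([X,Y]); computed with *)
(* the coordinate fields of chart_at p, which extend u and v and commute.   *)
Definition ext_deriv (a : form1) : form2 := fun p u v =>
  'D_u (fun x => form1_loc a (chart_at p) x v) (cmap (chart_at p) p) -
  'D_v (fun x => form1_loc a (chart_at p) x u) (cmap (chart_at p) p).

End Forms.

Record lie_group (R : realType) (n : nat) := LieGroup {
  lie_manifold :> manifold R n;
  lmul : lie_manifold -> lie_manifold -> lie_manifold;
  lone : lie_manifold;
  linv : lie_manifold -> lie_manifold;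
  lmulA : associative lmul;
  lmul1g : left_id lone lmul;
  lmulVg : left_inverse lone linv lmul;
  lmul_smooth : smooth_on (prod_atlas (atlas lie_manifold) (atlas lie_manifold))
    (atlas lie_manifold) setT (fun x => lmul x.1 x.2);
  linv_smooth : smooth_map linv }.

Arguments lone {R n} l.

(* L(G) is the tangent space at lone G, hence the type 'rV[R]_n. *)
Section LieGroup.
Context {R : realType} {n : nat} {G : lie_group R n}.

Definition Ad (g : G) : {linear 'rV[R]_n -> 'rV[R]_n} :=
  tangent_map (fun h : G => lmul (lmul g h) (linv g)) (lone G).

(* Defining property of exp: u |-> exp(uY) is the (unique) one-parameter *)
(* subgroup of G whose velocity at 0 is Y.                                *)
Definition is_exponential (lexp : 'rV[R]_n -> G) : Prop :=
  forall Y : 'rV[R]_n,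
    [/\ smooth_curve (fun u => lexp (u *: Y)),
        forall s u : R, lexp ((s + u) *: Y) = lmul (lexp (s *: Y)) (lexp (u *: Y)) &
        velocity (fun u => lexp (u *: Y)) 0 = Y].

End LieGroup.

(* U is a trivializing open set: (x, g) |-> psi x g is a G-equivariant *)
(* diffeomorphism from U x G to the part of P over U, covering U, with  *)
(* inverse p |-> (proj p, tau p).                                       *)
Definition is_trivialization (R : realType) (n m d : nat) (G : lie_group R n)
    (M : manifold R m) (P : manifold R d) (proj : P -> M) (act : P -> G -> P)
    (U : set M) (psi : M -> G -> P) (tau : P -> G) : Prop :=
  [/\ open U,
      smooth_on (prod_atlas (atlas M) (atlas G)) (atlas P) (U `*` setT)
        (fun x => psi x.1 x.2),
      smooth_on (atlas P) (atlas G) (proj @^-1` U) tau,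
      (forall x g, U x -> proj (psi x g) = x /\ tau (psi x g) = g) /\
      (forall p, U (proj p) -> psi (proj p) (tau p) = p) &
      forall x g h, U x -> psi x (lmul g h) = act (psi x g) h].

Record principal_bundle (R : realType) (n m d : nat) (G : lie_group R n)
    (M : manifold R m) := PrincipalBundle {
  bundle_total :> manifold R d;
  proj : bundle_total -> M;
  act : bundle_total -> G -> bundle_total;
  act1 : forall p, act p (lone G) = p;
  actM : forall p g h, act p (lmul g h) = act (act p g) h;
  act_smooth : smooth_on (prod_atlas (atlas bundle_total) (atlas G))
    (atlas bundle_total) setT (fun x => act x.1 x.2);
  proj_smooth : smooth_map proj;
  proj_act : forall p g, proj (act p g) = proj p;
  local_triv : forall x : M, exists U psi tau,
    U x /\ is_trivialization proj act U psi tau }.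

Section Bundle.
Context {R : realType} {n m d : nat} {G : lie_group R n} {M : manifold R m}.
Variable P : principal_bundle d G M.

Definition vertical (p : P) (v : 'rV[R]_d) : Prop :=
  tangent_map (@proj _ _ _ _ _ _ P) p v = 0.

Definition act_vec (p : P) (v : 'rV[R]_d) (g : G) : 'rV[R]_d :=
  tangent_map (fun q : P => act q g) p v.

Definition equivariant1 (a : form1 P n) : Prop :=
  forall (p : P) (v : 'rV[R]_d) (g : G),
    a (act p g) (act_vec p v g) = Ad (linv g) (a p v).

Definition equivariant2 (b : form2 P n) : Prop :=
  forall (p : P) (v w : 'rV[R]_d) (g : G),
    b (act p g) (act_vec p v g) (act_vec p w g) = Ad (linv g) (b p v w).

Definition horizontal1 (a : form1 P n) : Prop :=
  forall p v, vertical p v -> a p v = 0.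

Definition horizontal2 (b : form2 P n) : Prop :=
  forall p v w, vertical p v \/ vertical p w -> b p v w = 0.

Variable lexp : 'rV[R]_n -> G.

Definition fundamental (Y : 'rV[R]_n) (p : P) : 'rV[R]_d :=
  velocity (fun u : R => act p (lexp (u *: Y))) 0.

Definition connection_form (A : form1 P n) : Prop :=
  [/\ is_form1 A, equivariant1 A & forall p Y, A p (fundamental Y p) = Y].

Definition hor_part (A : form1 P n) (p : P) (v : 'rV[R]_d) : 'rV[R]_d :=
  v - fundamental (A p v) p.

(* the exterior covariant derivative of the connection form *)
Definition curvature (A : form1 P n) : form2 P n := fun p v w =>
  ext_deriv A p (hor_part A p v) (hor_part A p w).

End Bundle.

(* A smooth path on [pstart, pend] that is constant near both ends is         *)
(* represented by its unique extension to R that is constant outside          *)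
(* ]pstart, pend[ (which is again smooth); likewise for fields along a path.  *)
(* Paths that differ by a translation of time are different representatives   *)
(* of the same point of the path space.                                       *)
Record timed_path (R : realType) (T : Type) := Path {
  pstart : R;
  pend : R;
  pfun :> R -> T }.

Definition const_near_ends (R : realType) (T : Type) (t0 t1 : R) (f : R -> T) :=
  exists2 e : R, 0 < e &
    (forall t, t < t0 + e -> f t = f t0) /\ (forall t, t1 - e < t -> f t = f t1).

Section PathSpace.
Context {R : realType} {n m d : nat} {G : lie_group R n} {M : manifold R m}.
Variables (P : principal_bundle d G M) (lexp : 'rV[R]_n -> G).

Definition horizontal_path (Abar : form1 P n) (gam : timed_path R P) : Prop :=
  [/\ pstart gam < pend gam,
      smooth_curve gam,
      const_near_ends (pstart gam) (pend gam) gam &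
      forall t, pstart gam <= t <= pend gam -> Abar (gam t) (velocity gam t) = 0].

Definition path_tangent (Abar : form1 P n) (gam : timed_path R P)
    (v : R -> 'rV[R]_d) : Prop :=
  [/\ smooth_along gam v,
      const_near_ends (pstart gam) (pend gam) v &
      forall t, pstart gam <= t <= pend gam ->
        ((fun s => Abar (gam s) (v s))^`())%classic t
          = curvature lexp Abar (gam t) (velocity gam t) (v t)].

Definition act_path (gam : timed_path R P) (g : G) : timed_path R P :=
  Path (pstart gam) (pend gam) (fun t => act (gam t) g).

Definition act_field (gam : timed_path R P) (v : R -> 'rV[R]_d) (g : G) :
    R -> 'rV[R]_d :=
  fun t => act_vec (gam t) (v t) g.

Definition integral_rV (k : nat) (t0 t1 : R) (f : R -> 'rV[R]_k) : 'rV[R]_k :=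
  \row_j \int[@lebesgue_measure R]_(t in `[t0, t1]) f t 0 j.

Definition omega (A CL CR : form1 P n) (B : form2 P n) (gam : timed_path R P)
    (v : R -> 'rV[R]_d) : 'rV[R]_n :=
  let t0 := pstart gam in
  let t1 := pend gam in
  A (gam t0) (v t0) + CR (gam t1) (v t1) - CL (gam t0) (v t0)
  + integral_rV t0 t1 (fun t => B (gam t) (v t) (velocity gam t)).

End PathSpace.

(* Main.v *)
From HB Require Import structures.
Require Import Defs.
From mathcomp Require Import all_boot all_order all_algebra.
From mathcomp Require Import all_classical all_reals all_analysis.

(** Write Y~ for the fundamental field of Y, i.e. Y~ at p is the velocity at
    u = 0 of p exp(uY).

    (i) Each term of omega is equivariant separately.  For the endpoint terms
    this is the hypothesis on A, CL and CR.  For the integral, the velocity of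
    the translated path t |-> gam(t) g is gam'(t) g by the chain rule
    [velocity_act], so equivariance of B gives the integrand
    Ad(g^-1) B(v, gam'), and the linear map Ad(g^-1) has to be pulled out of
    the integral [integral_rV_linear].  That step needs the integrand to be
    integrable.  It is in fact continuous [form2_along_continuous]: near each
    time a single chart covers the path, and there B is a bilinear form with
    smooth coefficients.

    (ii) A(Y~) = Y for every connection form, and Y~ is vertical because proj
    is constant on fibres [fundamental_vertical], so CL, CR and B vanish on it
    and only A(Y~) = Y survives in omega.  The condition for Y~ to be tangent to
    the path space is dAbar(Y~)/dt = F(gam', Y~).  Its left side is the
    derivative of the constant Y, and its right side is zero because the
    curvature only sees the horizontal part of Y~, which is
    Y~ - (Abar(Y~))~ = 0.  The smoothness of t |-> Y~(gam(t)) comes from that of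
    the action: in charts, Y~ is the partial derivative of the action in the
    direction (0, Y) at the identity [to_chart_fundamental], a smooth function
    of the point, composed with the path.

    The manifold calculus rests on one local principle [diff_through_chart]:
    a composition h o g through a manifold may be differentiated by inserting
    the identity c^-1 o c of a chart c between h and g. *)

Set Implicit Arguments.
Unset Strict Implicit.
Unset Printing Implicit Defensive.

Import Order.TTheory GRing.Theory Num.Theory.
Import numFieldNormedType.Exports.

Local Open Scope classical_set_scope.
Local Open Scope ring_scope.

(** * Differentiability and C^k functions on open sets *)

(** A first-order expansion is a statement about the germ of the function, and
    it determines the differential. *)
Lemma near_eq_diff (R : realType) (V W : normedModType R) (f g : V -> W) x :
  (\forall y \near x, f y = g y) -> differentiable f x ->
  differentiable g x /\ 'd g x = 'd f x :> (V -> W).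
Proof.
move=> fg df.
have expand : g \o shift x = cst (g x) + 'd f x +o_ 0 id.
  apply/eqaddoP => _/posnumP[e].
  have fg0 : \forall h \near 0, f (h + x) = g (h + x).
    by move: fg; rewrite (near_shift 0 x) /=; apply: filterS => h /=; rewrite subr0.
  have /eqaddoP/(_ e%:num (gt0 e)) := diff_locally df.
  apply: filterS2 fg0 => h fgh; rewrite !fctE /= fgh.
  by rewrite (nbhs_singleton fg).
have dgE := diff_unique (diff_continuous df) expand.
by split=> //; apply/diff_locallyP; rewrite dgE; split=> //; exact: diff_continuous.
Qed.

Section Ck.
Variables (R : realType) (V : normedModType R).

(** Openness matters: [Ck_in] speaks of derivatives and limits in the ambient
    space, which only see a neighbourhood of the point. *)
Lemma Ck_in_ext (W : normedModType R) k (U : set V) (f g : V -> W) :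
  open U -> (forall x, U x -> f x = g x) -> Ck_in k U f -> Ck_in k U g.
Proof.
move=> oU; elim: k f g => [|k IH] f g fg /=.
  move=> Hf x Ux; rewrite /prop_for/continuous_at -(fg x)//; apply: cvg_trans (Hf x Ux).
  by apply: near_eq_cvg; near=> y; apply: fg; near: y; exact: open_nbhs_nbhs.
have nfg x : U x -> \forall y \near x, f y = g y.
  by move=> Ux; near=> y; apply: fg; near: y; exact: open_nbhs_nbhs.
move=> [dF DF]; split=> [x Ux|v]; first exact: (near_eq_diff (nfg x Ux) (dF x Ux)).1.
by apply: IH (DF v) => x Ux; apply: near_eq_derive; exact: nfg.
Unshelve. all: by end_near. Qed.

Lemma Ck_in_le (W : normedModType R) k (U : set V) (f : V -> W) :
  Ck_in k.+1 U f -> Ck_in k U f.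
Proof.
elim: k f => [|k IH] f [dF DF]; first by move=> x Ux; apply: differentiable_continuous (dF x Ux).
by split=> // v; exact: IH (DF v).
Qed.

Lemma Ck_in_sub (W : normedModType R) k (U U' : set V) (f : V -> W) :
  U' `<=` U -> Ck_in k U f -> Ck_in k U' f.
Proof.
move=> sU; elim: k f => [|k IH] f /=; first by move=> Hf x /sU; exact: Hf.
by move=> [dF DF]; split=> [x /sU|v]; [exact: dF|exact: IH].
Qed.

Lemma Ck_in_cst (W : normedModType R) k (U : set V) (a : W) : Ck_in k U (fun=> a).
Proof.
elim: k a => [|k IH] a /=; first by move=> x _; exact: cvg_cst.
split=> [x _|v]; first exact: differentiable_cst.
by rewrite [X in Ck_in _ _ X](_ : _ = fun=> 0)//; apply/funext => x; exact: derive_cst.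
Qed.

Lemma Ck_in_add (W : normedModType R) k (U : set V) (f g : V -> W) : open U ->
  Ck_in k U f -> Ck_in k U g -> Ck_in k U (fun x => f x + g x).
Proof.
move=> oU; elim: k f g => [|k IH] f g /=.
  by move=> Hf Hg x Ux; apply: cvgD; [exact: Hf|exact: Hg].
move=> [df Df] [dg Dg]; split=> [x Ux|v].
  by apply: differentiableD; [exact: df|exact: dg].
apply: Ck_in_ext (IH _ _ (Df v) (Dg v)) => // x Ux.
by rewrite -deriveD//; apply: diff_derivable; [exact: df|exact: dg].
Qed.

Lemma Ck_in_sum (W : normedModType R) k (U : set V) n (f : 'I_n -> V -> W) :
  open U -> (forall i, Ck_in k U (f i)) -> Ck_in k U (fun x => \sum_(i < n) f i x).
Proof.
move=> oU Hf.
elim: n f Hf => [|n IH] f Hf.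
  apply: Ck_in_ext (Ck_in_cst _ _ (0 : W)) => // x _; by rewrite big_ord0.
apply: Ck_in_ext (Ck_in_add oU (Hf ord0) (IH (fun i => f (lift ord0 i)) _)) => //.
by move=> x _; rewrite big_ord_recl.
Qed.

Lemma Ck_in_mul k (U : set V) (f g : V -> R) : open U ->
  Ck_in k U f -> Ck_in k U g -> Ck_in k U (fun x => f x * g x).
Proof.
move=> oU; elim: k f g => [|k IH] f g.
  by move=> Hf Hg x Ux; apply: cvgM; [exact: Hf|exact: Hg].
move=> Cf Cg; have [[df Df] [dg Dg]] := (Cf, Cg); split=> [x Ux|v].
  by apply: differentiableM; [exact: df|exact: dg].
have := Ck_in_add oU (IH _ _ (Ck_in_le Cf) (Dg v)) (IH _ _ (Ck_in_le Cg) (Df v)).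
apply: Ck_in_ext => // x Ux.
by rewrite -[RHS]/('D_v (f * g) x) deriveM//; apply: diff_derivable; [exact: df|exact: dg].
Qed.

Lemma Ck_in_coord k (U : set V) n (f : V -> 'rV[R]_n) j : open U ->
  Ck_in k U f -> Ck_in k U (fun x => f x 0 j : R).
Proof.
move=> oU; elim: k f => [|k IH] f.
  move=> Hf x Ux; apply: (@continuous_comp _ _ _ f (fun M : 'rV[R]_n => M 0 j)).
    exact: Hf.
  exact: coord_continuous.
move=> [df Df]; split=> [x Ux|v].
  apply: (@differentiable_comp _ _ _ _ f (fun M : 'rV[R]_n => M 0 j)).
    exact: df.
  exact: differentiable_coord.
apply: Ck_in_ext (IH _ (Df v)) => // x Ux.
by rewrite derive_mx ?mxE//; apply: diff_derivable; exact: df.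
Qed.

Lemma Ck_in_scale (W : normedModType R) k (U : set V) (f : V -> R) (w : W) :
  open U -> Ck_in k U f -> Ck_in k U (fun x => f x *: w).
Proof.
move=> oU; elim: k f => [|k IH] f.
  by move=> Hf x Ux; apply: cvgZr_tmp; exact: Hf.
move=> [df Df]; split=> [x Ux|v]; first by apply: differentiableZl; exact: df.
apply: Ck_in_ext (IH _ (Df v)) => // x Ux.
by rewrite !deriveE ?diffZl//; [exact: df|apply: differentiableZl; exact: df|exact: df].
Qed.

Lemma Ck_in_row k (U : set V) n (f : V -> 'rV[R]_n) : open U ->
  (forall j, Ck_in k U (fun x => f x 0 j : R)) -> Ck_in k U f.
Proof.
move=> oU Hf.
have := Ck_in_sum oU (fun j => Ck_in_scale ('e_j : 'rV[R]_n) oU (Hf j)).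
by apply: Ck_in_ext => // x _; rewrite -row_sum_delta.
Qed.

Lemma Ck_in_comp_scalar m k (U : set V) (D : set 'rV[R]_m) (f : V -> 'rV[R]_m)
    (g : 'rV[R]_m -> R) : open U -> (forall x, U x -> D (f x)) ->
  Ck_in k U f -> Ck_in k D g -> Ck_in k U (fun x => g (f x)).
Proof.
move=> oU UD; elim: k g => [|k IH] g.
  move=> Hf Hg x Ux; apply: (@continuous_comp _ _ _ f g); first exact: Hf.
  exact/Hg/UD.
move=> Cf Cg; have [[df Df] [dg Dg]] := (Cf, Cg); split=> [x Ux|v].
  by apply: (@differentiable_comp _ _ _ _ f g); [exact: df|exact/dg/UD].
have := Ck_in_sum oU (fun i => Ck_in_mul oU (Ck_in_coord i oU (Df v))
  (IH _ (Ck_in_le Cf) (Dg 'e_i))).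
apply: Ck_in_ext => // x Ux.
have dgx := dg _ (UD x Ux); have dfx := df x Ux.
have dc : differentiable (g \o f) x by exact: differentiable_comp.
rewrite -[RHS]/('D_v (g \o f) x) (deriveE _ dc) diff_comp//=.
rewrite -(deriveE v dfx) [in RHS](row_sum_delta ('D_v f x)) linear_sum.
by apply: eq_bigr => i _; rewrite [RHS]linearZ (deriveE _ dgx).
Qed.

End Ck.

(** Splitting the outer map into its coordinates reduces the chain rule to
    the product rule for scalar functions. *)
Lemma Ck_in_comp (R : realType) (V : normedModType R) m n k (U : set V)
    (D : set 'rV[R]_m) (f : V -> 'rV[R]_m) (g : 'rV[R]_m -> 'rV[R]_n) :
  open U -> open D -> (forall x, U x -> D (f x)) ->
  Ck_in k U f -> Ck_in k D g -> Ck_in k U (fun x => g (f x)).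
Proof.
move=> oU oD UD Cf Cg; apply: Ck_in_row => // j.
by apply: (Ck_in_comp_scalar (g := fun y => g y 0 j) oU UD Cf); exact: Ck_in_coord.
Qed.

(** The derivative of a slice in direction v is the slice of the derivative in
    direction (v, 0). *)
Lemma Ck_in_slice (R : realType) (V V' W : normedModType R) k (U : set (V * V'))
    (F : V * V' -> W) (y : V') :
  Ck_in k U F -> Ck_in k [set x | U (x, y)] (fun x => F (x, y)).
Proof.
elim: k F => [|k IH] F.
  move=> HF x Ux; apply: (@continuous_comp _ _ _ (fun x => (x, y)) F); last exact: HF.
  by apply: cvg_pair => //; exact: cvg_cst.
move=> [dF DF]; split=> [x Ux|v].
  apply: (@differentiable_comp _ _ _ _ (fun x => (x, y)) F); last exact: dF.
  by apply: differentiable_pair => //; exact: differentiable_cst.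
rewrite [X in Ck_in _ _ X](_ : _ = fun x => 'D_(v, 0) F (x, y)); first exact: IH (DF (v, 0)).
apply/funext => x; rewrite /derive; congr (lim _).
rewrite [X in X @ _](_ : _ = fun h => h^-1 *: (F (h *: (v, 0) + (x, y)) - F (x, y)))//.
apply/funext => h /=; congr (_ *: (F _ - _)).
by congr (_, _); rewrite /= scaler0 add0r.
Qed.

(** * Calculus in charts *)

(** Near x, h o g is the composition of h o c^-1 with c o g, two maps between
    normed spaces.  The chart is described by its open domain and its left
    inverse, so that charts of a manifold and products of two of them are
    treated alike. *)
Lemma diff_through_chart (R : realType) (T : topologicalType)
    (V E W : normedModType R) (c : chart T E) (g : V -> T) (h : T -> W) (x : V) :
  open (cdom c) -> (forall p, cdom c p -> cinv c (cmap c p) = p) ->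
  cdom c (g x) -> {for x, continuous g} ->
  differentiable (cmap c \o g) x ->
  differentiable (h \o cinv c) (cmap c (g x)) ->
  differentiable (h \o g) x /\
  forall v, 'd (h \o g) x v = 'd (h \o cinv c) (cmap c (g x)) ('d (cmap c \o g) x v).
Proof.
move=> oc cK cgx gx dg dh.
have near_g : \forall y \near x, ((h \o cinv c) \o (cmap c \o g)) y = (h \o g) y.
  have : \forall y \near x, cdom c (g y).
    by apply: gx; exact: open_nbhs_nbhs.
  by apply: filterS => y cgy; rewrite /= cK.
have [dhg ->] := near_eq_diff near_g (differentiable_comp dg dh).
by split=> // v; rewrite diff_comp.
Qed.

Section Charts.
Variables (R : realType) (m : nat) (M : manifold R m).
Implicit Types (c d e : chart M 'rV[R]_m) (p : M).

Lemma chart_open c : atlas M c -> open (cdom c).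
Proof. by case/atlas_chart => -[]. Qed.

Lemma cinv_img c x : atlas M c -> cimg c x -> cdom c (cinv c x) /\ cmap c (cinv c x) = x.
Proof. by case/atlas_chart => _ cK _ _ [p cp <-]; rewrite cK. Qed.

Lemma transition_diff c d p : atlas M c -> atlas M d -> cdom c p -> cdom d p ->
  differentiable (cmap d \o cinv c) (cmap c p).
Proof. by move=> ac ad cp dp; apply: ((atlas_compat ac ad) 1%N).1; exists p. Qed.

(** The cocycle rule for changes of charts. *)
Lemma transition_comp c d e p v : atlas M c -> atlas M d -> atlas M e ->
  cdom c p -> cdom d p -> cdom e p ->
  'd (cmap e \o cinv c) (cmap c p) v =
  'd (cmap e \o cinv d) (cmap d p) ('d (cmap d \o cinv c) (cmap c p) v).
Proof.
move=> ac ad ae cp dp ep.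
have [_ cK _ cc] := atlas_chart ac; have [[od _] dK _ _] := atlas_chart ad.
have img : cimg c (cmap c p) by exists p.
have := @diff_through_chart _ _ _ _ _ d (cinv c) (cmap e) (cmap c p) od dK.
rewrite cK//; case=> //.
- exact: cc.
- exact: transition_diff.
- exact: transition_diff.
Qed.

Lemma transition_id c p v : atlas M c -> cdom c p ->
  'd (cmap c \o cinv c) (cmap c p) v = v.
Proof.
move=> ac cp; have [[_ oc] _ _ _] := atlas_chart ac.
have near_id : \forall x \near cmap c p, id x = (cmap c \o cinv c) x.
  have : nbhs (cmap c p) (cimg c) by apply: open_nbhs_nbhs; split=> //; exists p.
  by apply: filterS => x /(cinv_img ac)[].
have idd : differentiable (id : 'rV[R]_m -> 'rV[R]_m) (cmap c p) by [].
have [_ ->] := near_eq_diff near_id idd.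
by rewrite diff_val.
Qed.

(** The cocycle rule along chart_at p, c, chart_at p. *)
Lemma of_to_chart c p v : atlas M c -> cdom c p -> of_chart c p (to_chart c p v) = v.
Proof.
move=> ac cp; rewrite /of_chart /to_chart.
rewrite -transition_comp//; try exact: chart_at_atlas; try exact: chart_at_dom.
by apply: transition_id; [exact: chart_at_atlas|exact: chart_at_dom].
Qed.

End Charts.

Section Curves.
Variables (R : realType) (m : nat) (M : manifold R m).

Definition curve_diff (c : R -> M) (t : R) :=
  {for t, continuous (c : R^o -> M)} /\
  forall d, atlas M d -> cdom d (c t) -> differentiable (cmap d \o c : R^o -> _) t.

Lemma smooth_curve_diff (c : R -> M) t : smooth_curve c -> curve_diff c t.
Proof.
move=> [cc sc]; split=> [|d ad dt]; first exact: cc.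
have /(_ 1%N)[+ _] := sc (Chart setT id id) d erefl ad; apply.
by exists t.
Qed.

(** The chain rule for a function h on the manifold along a curve, with the
    differential of h taken in any chart at the point. *)
Lemma velocity_through_chart (W : normedModType R) (c : R -> M) t d (h : M -> W) :
  curve_diff c t -> atlas M d -> cdom d (c t) ->
  differentiable (h \o cinv d) (cmap d (c t)) ->
  differentiable (h \o c : R^o -> W) t /\
  (h \o c)^`()%classic t = 'd (h \o cinv d) (cmap d (c t)) ((cmap d \o c)^`()%classic t).
Proof.
move=> [cc dc] ad dt dh; have [[od _] dK _ _] := atlas_chart ad.
have [dhc hcE] := @diff_through_chart _ _ R^o _ _ d c h t od dK dt cc (dc d ad dt) dh.
by split=> //; rewrite !derive1E'//; exact: dc.
Qed.

Lemma to_chart_velocity (c : R -> M) t d : curve_diff c t -> atlas M d ->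
  cdom d (c t) -> to_chart d (c t) (velocity c t) = (cmap d \o c)^`()%classic t.
Proof.
move=> dc ad dt; rewrite /to_chart /velocity.
have [ae et] := (@chart_at_atlas _ _ M (c t), chart_at_dom (c t)).
by have [] := velocity_through_chart dc ae et (transition_diff ae ad et dt).
Qed.

End Curves.

Section Maps.
Variables (R : realType) (m n : nat) (M : manifold R m) (N : manifold R n).

Lemma velocity_comp (f : M -> N) (c : R -> M) t : curve_diff c t ->
  differentiable (cmap (chart_at (f (c t))) \o f \o cinv (chart_at (c t)))
    (cmap (chart_at (c t)) (c t)) ->
  velocity (f \o c) t = tangent_map f (c t) (velocity c t).
Proof.
move=> dc df.
by have [] := velocity_through_chart dc (chart_at_atlas _) (chart_at_dom _) df.
Qed.

Lemma smooth_map_diff (f : M -> N) p c d : smooth_map f -> atlas M c -> atlas N d ->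
  cdom c p -> cdom d (f p) -> differentiable (cmap d \o f \o cinv c) (cmap c p).
Proof.
move=> [_ sf] ac ad cp dp; have /(_ 1%N)[+ _] := sf c d ac ad; apply.
by exists p.
Qed.

End Maps.

(** * Fundamental vector fields of a principal bundle *)

Section LieGroups.
Variables (R : realType) (n : nat) (G : lie_group R n) (lexp : 'rV[R]_n -> G).
Hypothesis hexp : is_exponential lexp.

Lemma lexp0 : lexp 0 = lone G.
Proof.
have [_ /(_ 0 0) + _] := hexp 0; rewrite addr0 scaler0 => idem.
have := congr1 (lmul (linv (lexp 0))) idem.
by rewrite lmulA !lmulVg lmul1g.
Qed.

End LieGroups.

Section Bundles.
Variables (R : realType) (n m d : nat) (G : lie_group R n) (M : manifold R m).
Variable P : principal_bundle d G M.

(** The action P x G -> P read in the charts c and e of the source and c' of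
    the target. *)
Definition act_loc (c : chart P 'rV[R]_d) (e : chart G 'rV[R]_n) (c' : chart P 'rV[R]_d) :
    'rV[R]_d * 'rV[R]_n -> 'rV[R]_d :=
  (cmap c' \o (fun x : P * G => act x.1 x.2)) \o cinv (prod_chart c e).

(** The set on which smoothness of the action, as a map between manifolds,
    says that [act_loc] is smooth. *)
Definition act_loc_dom (c : chart P 'rV[R]_d) (e : chart G 'rV[R]_n)
    (c' : chart P 'rV[R]_d) : set ('rV[R]_d * 'rV[R]_n) :=
  cmap (prod_chart c e) @` (cdom (prod_chart c e) `&` setT `&`
    (fun x : P * G => act x.1 x.2) @^-1` cdom c').

Lemma act_loc_smooth c e c' : atlas P c -> atlas G e -> atlas P c' ->
  smooth_in (act_loc_dom c e c') (act_loc c e c').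
Proof. by move=> ac ae ac'; apply: (act_smooth P).2 => //; exists c, e. Qed.

Lemma act_loc_domP c e c' p g : cdom c p -> cdom e g -> cdom c' (act p g) ->
  act_loc_dom c e c' (cmap c p, cmap e g).
Proof. by move=> cp eg c'pg; exists (p, g). Qed.

(** In charts, translation by g is the slice of the action at the coordinates
    of g. *)
Lemma act_diff p g c c' : atlas P c -> atlas P c' -> cdom c p ->
  cdom c' (act p g) ->
  differentiable (cmap c' \o (fun q : P => act q g) \o cinv c) (cmap c p).
Proof.
move=> ac ac' cp cpg; pose e := chart_at g.
have ae : atlas G e by exact: chart_at_atlas.
have [_ eK _ _] := atlas_chart ae; have eg : cdom e g by exact: chart_at_dom.
have [+ _] := Ck_in_slice (cmap e g) (act_loc_smooth ac ae ac' 1%N).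
move=> /(_ _ (act_loc_domP cp eg cpg)).
by congr (differentiable _ _); apply/funext => x; rewrite /act_loc /= eK.
Qed.

(** The curve u |-> (p, gam u) in P x G has velocity (0, gam'), since its first
    component does not move. *)
Lemma act_curve_deriv (gam : R -> G) t p c e c' : curve_diff gam t ->
  atlas P c -> atlas G e -> atlas P c' ->
  cdom c p -> cdom e (gam t) -> cdom c' (act p (gam t)) ->
  differentiable (cmap c' \o (fun u => act p (gam u)) : R^o -> _) t /\
  (cmap c' \o (fun u => act p (gam u)))^`()%classic t =
  'D_(0, (cmap e \o gam)^`()%classic t) (act_loc c e c') (cmap c p, cmap e (gam t)).
Proof.
move=> [gc gd] ac ae ac' cp eg c'pg.
have [[oc _] cK _ _] := atlas_chart ac; have [[oe _] eK _ _] := atlas_chart ae.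
pose g : R^o -> P * G := fun u => (p, gam u).
have op : open (cdom (prod_chart c e)).
  rewrite openE => -[q h] [/= cq eh]; exists (cdom c, cdom e) => //.
  by split; apply: open_nbhs_nbhs.
have pK x : cdom (prod_chart c e) x -> cinv (prod_chart c e) (cmap (prod_chart c e) x) = x.
  by case: x => q h [/= cq eh]; rewrite cK// eK.
have gcont : {for t, continuous g} by apply: cvg_pair => //; exact: cvg_cst.
have dge : differentiable (cmap e \o gam : R^o -> _) t by exact: gd.
have dcst : differentiable (fun _ : R^o => cmap c p) t by exact: differentiable_cst.
have dg : differentiable (cmap (prod_chart c e) \o g) t.
  exact: (differentiable_pair dcst dge).
have dact : differentiable (act_loc c e c') (cmap c p, cmap e (gam t)).
  by apply: (act_loc_smooth ac ae ac' 1%N).1; exact: act_loc_domP.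
have [|dh dhE] := @diff_through_chart _ _ R^o _ _ (prod_chart c e) g
  (cmap c' \o (fun x : P * G => act x.1 x.2)) t op pK _ gcont dg dact.
  by split.
split; first exact: dh.
rewrite derive1E'; last exact: dh.
rewrite [LHS]dhE deriveE//; congr ('d (act_loc c e c') _ _).
rewrite -[cmap _ \o g]/(fun u => (cmap c p, (cmap e \o gam) u)) (diff_pair dcst dge) /=.
by rewrite derive1E'// [X in (X _, _)]diff_cst.
Qed.

Variables (lexp : 'rV[R]_n -> G).
Hypothesis hexp : is_exponential lexp.

Lemma fundamental_curve Y (p : P) :
  curve_diff (fun u : R => act p (lexp (u *: Y))) 0.
Proof.
have [sY _ _] := hexp Y; have dY := smooth_curve_diff 0 sY.
split.
  apply: (@continuous_comp _ _ _ (fun u : R^o => (p, lexp (u *: Y)))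
    (fun x : P * G => act x.1 x.2)).
    by apply: cvg_pair; [exact: cvg_cst|exact: dY.1].
  exact: (act_smooth P).1.
move=> c' ac' c'p.
have [] // := act_curve_deriv dY (chart_at_atlas p)
  (chart_at_atlas (lexp (0 *: Y))) ac' (chart_at_dom p) (chart_at_dom _) c'p.
Qed.

Lemma act_lexp0 (p : P) Y : act p (lexp (0 *: Y)) = p.
Proof. by rewrite scale0r (lexp0 hexp) act1. Qed.

(** This formula is what makes a fundamental field smooth: it exhibits it as a
    partial derivative of the action, at a fixed second argument and in a
    fixed direction. *)
Lemma to_chart_fundamental Y (p : P) c : atlas P c -> cdom c p ->
  to_chart c p (fundamental lexp Y p) =
  'D_(0, Y) (act_loc c (chart_at (lone G)) c)
    (cmap c p, cmap (chart_at (lone G)) (lone G)).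
Proof.
move=> ac cp; have [sY _ vY] := hexp Y; have dY := smooth_curve_diff 0 sY.
have := to_chart_velocity (fundamental_curve Y p) ac.
rewrite /= act_lexp0 => ->//.
have [|_ ->] := act_curve_deriv dY ac (chart_at_atlas (lexp (0 *: Y))) ac cp
  (chart_at_dom _); first by rewrite act_lexp0.
move: vY; rewrite /velocity => ->.
by rewrite scale0r (lexp0 hexp).
Qed.

(** The curve p exp(uY) stays in one fibre, so its projection is constant. *)
Lemma fundamental_vertical Y (p : P) : vertical p (fundamental lexp Y p).
Proof.
have pE := act_lexp0 p Y.
have := velocity_comp (f := @Defs.proj _ _ _ _ _ _ P) (fundamental_curve Y p).
rewrite /= !pE => E; rewrite /vertical /fundamental -E; last first.
  by apply: smooth_map_diff (proj_smooth P) _ _ _ _;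
    try exact: chart_at_atlas; exact: chart_at_dom.
set x := Defs.proj p.
rewrite /velocity derive1E (_ : _ \o _ = cst (cmap (chart_at x) x)).
  exact: derive_cst.
by apply/funext => u /=; rewrite !proj_act.
Qed.

Lemma velocity_act (gam : R -> P) t g : curve_diff gam t ->
  velocity (fun s => act (gam s) g) t = act_vec (gam t) (velocity gam t) g.
Proof.
move=> dgam; apply: (velocity_comp (f := fun q : P => act q g)) => //.
by apply: act_diff; try exact: chart_at_atlas; exact: chart_at_dom.
Qed.

(** The coordinates of the field along gam are a smooth function of the base
    point [to_chart_fundamental] composed with the coordinates of gam. *)
Lemma smooth_along_fundamental (gam : R -> P) Y : smooth_curve gam ->
  smooth_along gam (fun t => fundamental lexp Y (gam t)).
Proof.
move=> sgam c ac k; pose e := chart_at (lone G).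
have [gc /(_ _ _ erefl ac k)] := sgam.
set I := (X in Ck_in k X _) => Cgam.
have IE : I = [set t | cdom c (gam t)].
  apply/seteqP; split=> [_ [t [_ ct] <-]//|t ct]; by exists t.
rewrite IE in Cgam.
have oI : open ([set t | cdom c (gam t)] : set R^o).
  apply: open_comp (chart_open ac) => t _; exact: gc.
have oc : open (cimg c) by case/atlas_chart: ac => -[].
have [_ /(_ (0, Y))] := act_loc_smooth ac (chart_at_atlas (lone G)) ac k.+1.
move=> /(Ck_in_slice (cmap e (lone G))) Cact.
(* p 1 = p, so the slice at the identity is defined on the whole chart. *)
have {}Cact : Ck_in k (cimg c)
   (fun x => 'D_(0, Y) (act_loc c e c) (x, cmap e (lone G))).
  apply: Ck_in_sub Cact => _ [p cp <-] /=.
  by apply: act_loc_domP => //; [exact: chart_at_dom|rewrite act1].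
have CC := Ck_in_comp oI oc _ Cgam Cact.
apply: (Ck_in_ext oI _ (CC _)) => t ct; last by exists (gam t).
by rewrite to_chart_fundamental.
Qed.

End Bundles.

(** * The integral along a path *)

Section Integral.
Variable R : realType.
Local Notation mu := (@lebesgue_measure R).

Lemma linear_row_expand (W : lmodType R) n (f : 'rV[R]_n -> W) (u : 'rV[R]_n) :
  linear f -> f u = \sum_i u 0 i *: f 'e_i.
Proof.
move=> lf; pose L : {linear 'rV[R]_n -> W} :=
  HB.pack f (GRing.isLinear.Build _ _ _ _ f lf).
rewrite -[f]/(L : _ -> _) [in LHS](row_sum_delta u) linear_sum.
by apply: eq_bigr => i _; rewrite linearZ.
Qed.

Lemma continuous_integrable (a b : R) (f : R -> R) : continuous f ->
  mu.-integrable `[a, b] (EFin \o f).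
Proof.
move=> cf; apply: continuous_compact_integrable; first exact: segment_compact.
exact: continuous_subspaceT.
Qed.

Lemma Rintegral_sum_continuous (a b : R) n (f : 'I_n -> R -> R) :
  (forall i, continuous (f i)) ->
  \int[mu]_(t in `[a, b]) (\sum_i f i t) = \sum_i \int[mu]_(t in `[a, b]) f i t.
Proof.
elim: n f => [|n IH] f cf.
  rewrite big_ord0 -[RHS](mul0r (fine (mu `[a, b]))) -Rintegral_cst//.
  by apply: eq_Rintegral => t _; rewrite big_ord0.
rewrite big_ord_recl -IH => [|i]; last exact: cf.
rewrite -RintegralD//; try exact: continuous_integrable.
  by apply: eq_Rintegral => t _; rewrite big_ord_recl.
apply: continuous_integrable => t.
apply: (@Ck_in_sum _ _ _ 0 setT _ (fun i => f (lift ord0 i)) openT) => // i x _.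
exact: cf.
Qed.

(** The integral is taken entry by entry, so commuting with L amounts to
    linearity of the integral on the entries of f, which have to be
    integrable. *)
Lemma integral_rV_linear k l (a b : R) (L : {linear 'rV[R]_k -> 'rV[R]_l})
    (f : R -> 'rV[R]_k) : (forall j, continuous (fun t => f t 0 j)) ->
  integral_rV a b (fun t => L (f t)) = L (integral_rV a b f).
Proof.
move=> cf; apply/rowP => i.
have expand u : L u 0 i = \sum_j L 'e_j 0 i * u 0 j.
  rewrite (linear_row_expand u (linearP L)) summxE.
  by apply: eq_bigr => j _; rewrite mxE mulrC.
rewrite mxE expand; under eq_Rintegral do rewrite expand.
rewrite Rintegral_sum_continuous => [|j t].
  apply: eq_bigr => j _; rewrite RintegralZl//; first by rewrite mxE.
  exact: continuous_integrable.
by apply: cvgM; [exact: cvg_cst|exact: cf].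
Qed.

End Integral.

Section Forms.
Variables (R : realType) (m n : nat) (M : manifold R m).

Lemma form2_loc_expand (B : form2 M n) c x u w : is_form2 B ->
  form2_loc B c x u w =
  \sum_i u 0 i *: \sum_j w 0 j *: form2_loc B c x 'e_i 'e_j.
Proof.
move=> [lin2 lin1 _ _].
rewrite (linear_row_expand (f := fun u => form2_loc B c x u w)).
  apply: eq_bigr => i _; congr (_ *: _).
  apply: (linear_row_expand (f := form2_loc B c x 'e_i)) => a v1 v2.
  by rewrite /form2_loc /of_chart linearP lin2.
by move=> a v1 v2; rewrite /form2_loc /of_chart linearP lin1.
Qed.

(** In one chart around gam t the value is a finite sum of products of
    coordinates of v, coordinates of the velocity and coefficients of B along
    gam. *)
Lemma form2_along_continuous (B : form2 M n) (gam : R -> M) (v : R -> 'rV[R]_m) j :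
  is_form2 B -> smooth_curve gam -> smooth_along gam v ->
  continuous (fun t => B (gam t) (v t) (velocity gam t) 0 j).
Proof.
move=> hB sgam sv t; pose c := chart_at (gam t).
have ac : atlas M c by exact: chart_at_atlas.
have [_ cK _ _] := atlas_chart ac.
pose I : set R^o := [set s | cdom c (gam s)].
have It : I t by exact: chart_at_dom.
have oI : open I by apply: open_comp (chart_open ac) => s _; exact: sgam.1.
have Cgam k : Ck_in k I (cmap c \o gam : R^o -> _).
  have := sgam.2 (Chart setT id id) c erefl ac k.
  by apply: Ck_in_sub => s Is; exists s.
have [_ _ _ /(_ c ac) sB] := hB.
have oc : open (cimg c) by case/atlas_chart: ac => -[].
have CB i i' : Ck_in 0 I (fun s => form2_loc B c (cmap c (gam s)) 'e_i 'e_i').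
  by apply: (Ck_in_comp oI oc _ (Cgam 0%N) (sB 'e_i 'e_i' 0%N)) => s Is; exists (gam s).
(* of_chart inverts to_chart, so B may be evaluated through its coefficients
   in c. *)
suff C : Ck_in 0 I (fun s => \sum_i (to_chart c (gam s) (v s)) 0 i *
   \sum_i' ('D_1 (cmap c \o gam : R^o -> _) s) 0 i' *
     (form2_loc B c (cmap c (gam s)) 'e_i 'e_i') 0 j : R).
  have := Ck_in_ext oI _ C; apply => // s Is.
  transitivity (form2_loc B c (cmap c (gam s)) (to_chart c (gam s) (v s))
    (to_chart c (gam s) (velocity gam s)) 0 j).
    rewrite form2_loc_expand// summxE; apply: eq_bigr => i _.
    rewrite mxE summxE; congr (_ * _); apply: eq_bigr => i' _; rewrite mxE.
    by rewrite to_chart_velocity ?derive1E//; exact: smooth_curve_diff.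
  by rewrite /form2_loc cK// !of_to_chart.
apply: Ck_in_sum => // i; apply: Ck_in_mul => //.
  by apply: Ck_in_coord => //; exact: (sv c ac 0%N).
apply: Ck_in_sum => // i'; apply: Ck_in_mul => //.
  apply: (Ck_in_coord (f := 'D_1 (cmap c \o gam : R^o -> _))) => //.
  exact: (Cgam 1%N).2.
exact: Ck_in_coord.
Qed.

End Forms.

(** * The form omega *)

(** One term differentiates the zero function x |-> a(0), the other one
    differentiates in direction 0. *)
Lemma ext_deriv0r (R : realType) (m n : nat) (M : manifold R m) (a : form1 M n) p u :
  ext_deriv a p u 0 = 0.
Proof.
rewrite /ext_deriv derive0 subr0 (_ : (fun x => _) = cst 0) ?derive_cst//.
by apply/funext => x; rewrite /form1_loc /of_chart !linear0.
Qed.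

Section Omega.
Variables (R : realType) (n m d : nat) (G : lie_group R n) (M : manifold R m).
Variables (P : principal_bundle d G M) (lexp : 'rV[R]_n -> G).

(** A fundamental vector has no horizontal part. *)
Lemma curvature_fundamental (a : form1 P n) (p : P) u Y :
  connection_form lexp a -> curvature lexp a p u (fundamental lexp Y p) = 0.
Proof.
move=> [_ _ aY]; rewrite /curvature.
by rewrite [hor_part _ _ _ (fundamental _ _ _)]/hor_part aY subrr ext_deriv0r.
Qed.

Lemma fundamental_path_tangent (Abar : form1 P n) (gam : timed_path R P) Y :
  is_exponential lexp -> connection_form lexp Abar -> horizontal_path Abar gam ->
  path_tangent lexp Abar gam (fun t => fundamental lexp Y (gam t)).
Proof.
move=> hexp hA [_ sgam [e e0 [cst0 cst1]] _]; split.
- exact: smooth_along_fundamental.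
- by exists e => //; split=> t /= ht; [rewrite cst0|rewrite cst1].
- move=> t _; rewrite curvature_fundamental//; case: hA => _ _ AY.
  rewrite (_ : (fun s => _) = cst Y); first exact: derive1_cst.
  by apply/funext => s; rewrite AY.
Qed.

Lemma omega_fundamental (A CL CR : form1 P n) (B : form2 P n)
    (gam : timed_path R P) Y :
  is_exponential lexp -> (forall p, A p (fundamental lexp Y p) = Y) ->
  horizontal1 CL -> horizontal1 CR -> horizontal2 B ->
  omega A CL CR B gam (fun t => fundamental lexp Y (gam t)) = Y.
Proof.
move=> hexp AY hCL hCR hB; have vY p := fundamental_vertical hexp Y (p : P).
rewrite /omega AY hCL// hCR// addr0 subr0 -[RHS]addr0; congr (_ + _).
apply/rowP => j; rewrite !mxE.
rewrite -[RHS](mul0r (fine (@lebesgue_measure R `[pstart gam, pend gam]))).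
rewrite -Rintegral_cst//; apply: eq_Rintegral => t _.
by rewrite hB ?mxE//; left.
Qed.

Lemma omega_equivariant (A CL CR : form1 P n) (B : form2 P n) (g : G)
    (gam : timed_path R P) v :
  equivariant1 A -> equivariant1 CL -> equivariant1 CR ->
  is_form2 B -> equivariant2 B -> smooth_curve gam -> smooth_along gam v ->
  omega A CL CR B (act_path gam g) (act_field gam v g)
  = Ad (linv g) (omega A CL CR B gam v).
Proof.
move=> eA eCL eCR hB eB sgam sv.
rewrite /omega /= /act_field eA eCL eCR linearD linearB linearD; congr (_ + _).
rewrite -integral_rV_linear; last by move=> j; exact: form2_along_continuous.
congr integral_rV; apply/funext => t.
by rewrite velocity_act ?eB//; exact: smooth_curve_diff.
Qed.

End Omega.

Theorem proposition3p1
  (R : realType) (n m d : nat)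
  (G : lie_group R n) (M : manifold R m) (P : principal_bundle d G M)
  (lexp : 'rV[R]_n -> G) (hexp : is_exponential lexp)
  (Abar A : form1 P n)
  (hAbar : connection_form lexp Abar) (hA : connection_form lexp A)
  (B0 : form2 P n)
  (hB0 : is_form2 B0) (hB0_eq : equivariant2 B0) (hB0_hor : horizontal2 B0)
  (CL0 CR0 : form1 P n)
  (hCL0 : is_form1 CL0) (hCL0_eq : equivariant1 CL0) (hCL0_hor : horizontal1 CL0)
  (hCR0 : is_form1 CR0) (hCR0_eq : equivariant1 CR0) (hCR0_hor : horizontal1 CR0) :
  (forall (g : G) (gam : timed_path R P) (v : R -> 'rV[R]_d),
     horizontal_path Abar gam -> path_tangent lexp Abar gam v ->
     omega A CL0 CR0 B0 (act_path gam g) (act_field gam v g)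
       = Ad (linv g) (omega A CL0 CR0 B0 gam v))
  /\
  (forall (Y : 'rV[R]_n) (gam : timed_path R P) (Ytilde : R -> 'rV[R]_d),
     horizontal_path Abar gam ->
     (forall t : R,
        Ytilde t = velocity (fun u : R => act (gam t) (lexp (u *: Y)%R)) 0%R) ->
     path_tangent lexp Abar gam Ytilde /\
     omega A CL0 CR0 B0 gam Ytilde = Y).
Proof.
have [_ eqA AY] := hA.
split=> [g gam v [_ sgam _ _] [sv _ _]|Y gam Ytilde hgam YtildeE].
  exact: omega_equivariant.
have -> : Ytilde = fun t => fundamental lexp Y (gam t) by apply/funext.
split; first exact: fundamental_path_tangent.
exact: omega_fundamental.
Qed.
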